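(* Let $L$ and $P$ be any two countable posets, and write $L^*=\sigma(L)$ and $P^*=\sigma(P)$ for the complete lattices of Scott open subsets of $L$ and $P$, ordered by inclusion. Then the Scott space $\Sigma(L^*\times P^* )$ of the product poset $L^*\times P^*$ is sober.
   Context: A subset $U$ of a poset $P$ is Scott open if it is an upper set and, for every directed (nonempty) $D\subseteq P$ whose supremum exists, $\sup D\in U$ implies $D\cap U\neq\emptyset$. The Scott open sets form the Scott topology $\sigma(P)$, and $\Sigma P=(P,\sigma(P))$ is the Scott space of $P$. The product of posets carries the componentwise order. A $T_0$ space is sober if every nonempty irreducible closed subset is the closure of a unique singleton. *)

(* Defs.v *)
From HB Require Import structures.
From mathcomp Require Import all_boot all_order.
From mathcomp Require Import boolp classical_sets cardinality topology.

Set Implicit Arguments.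
Unset Strict Implicit.
Unset Printing Implicit Defensive.

Import Order.TTheory.

Local Open Scope classical_set_scope.
Local Open Scope order_scope.

Section ScottOpen.
Context {d : Order.disp_t} {P : porderType d}.
Implicit Types (U D : set P).

Definition upper_set U := forall x y, U x -> x <= y -> U y.

Definition directed D :=
  D !=set0 /\ forall x y, D x -> D y -> exists2 z, D z & x <= z /\ y <= z.

Definition scott_open U :=
  upper_set U /\
  forall D s, directed D -> isLub D s -> U s -> D `&` U !=set0.

Lemma scott_openT : scott_open [set: P].
Proof.
split=> // D s [[x Dx] _] _ _; by exists x.
Qed.

Lemma scott_openI : setI_closed scott_open.
Proof.
move=> U V [upU soU] [upV soV]; split.
  by move=> x y [Ux Vx] xy; split; [exact: upU xy | exact: upV xy].
move=> D s dD Ds [Us Vs]; have [x [Dx Ux]] := soU _ _ dD Ds Us.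
have [y [Dy Vy]] := soV _ _ dD Ds Vs.
have [z Dz [xz yz]] := dD.2 _ _ Dx Dy.
by exists z; split=> //; split; [exact: upU xz | exact: upV yz].
Qed.

Lemma scott_open_bigU (I : Type) (F : I -> set P) :
  (forall i, scott_open (F i)) -> scott_open (\bigcup_i F i).
Proof.
move=> soF; split.
  by move=> x y [i _ Fx] xy; exists i => //;
    exact: (soF i).1 xy.
move=> D s dD Ds [i _ Fs]; have [x [Dx Fx]] := (soF i).2 _ _ dD Ds Fs.
by exists x; split=> //; exists i.
Qed.

End ScottOpen.

(* The lattice sigma(P), as a subtype of [set P]; the latter is ordered by
   inclusion. *)
Record scott_opens (d : Order.disp_t) (P : porderType d) := ScottOpens {
  scott_opens_set :> set P;
  _ : `[< scott_open scott_opens_set >] }.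

HB.instance Definition _ d (P : porderType d) :=
  [isSub for @scott_opens_set d P].
HB.instance Definition _ d (P : porderType d) :=
  [Choice of scott_opens P by <:].
HB.instance Definition _ d (P : porderType d) :=
  [SubChoice_isSubPOrder of scott_opens P by <: with set_display].

Lemma scott_opens_leP (d : Order.disp_t) (P : porderType d)
  (U V : scott_opens P) : reflect ((U : set P) `<=` V) (U <= V).
Proof. by rewrite -Order.le_val; exact: subsetPset. Qed.

Lemma scott_opens_complete (d : Order.disp_t) (P : porderType d)
  (F : set (scott_opens P)) : exists U, isLub F U.
Proof.
have soF : `[< scott_open (\bigcup_(V : {V | F V}) (sval V : set P)) >].
  by apply/asboolP/scott_open_bigU => -[[V soV] FV]; exact: asboolW soV.
exists (ScottOpens soF); split=> [V FV | W ubW]; apply/scott_opens_leP => x.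
  by exists (exist _ V FV).
by case=> -[V FV] _ /=; have /scott_opens_leP := ubW _ FV; apply.
Qed.

(* An alias, so that the Scott topology does not compete with other topologies
   on the carrier (in particular the product topology on a pair type). *)
Definition scott_space (d : Order.disp_t) (P : porderType d) : Type := P.

HB.instance Definition _ d (P : porderType d) :=
  Choice.on (scott_space P).
HB.instance Definition _ d (P : porderType d) :=
  isOpenTopological.Build (scott_space P)
    (@scott_openT d P) (@scott_openI d P) (@scott_open_bigU d P).

Lemma scott_spaceE (d : Order.disp_t) (P : porderType d) (U : set P) :
  open (U : set (scott_space P)) = scott_open U.
Proof.
rewrite propeqE openE; split=> [oU | soU x Ux]; last first.
  by exists U; split.
suff -> : U = \bigcup_(V : {V | scott_open V /\ V `<=` U}) sval V.
  by apply: scott_open_bigU => -[V []].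
apply/seteqP; split=> [x /oU [V [soV Vx VU]] | x [[V [soV VU]] _ /VU]] //.
by exists (exist _ V (conj soV VU)).
Qed.

Section Sober.
Context {T : topologicalType}.

Definition irreducible (A : set T) :=
  A !=set0 /\
  forall B C, closed B -> closed C -> A `<=` B `|` C -> A `<=` B \/ A `<=` C.

End Sober.

Definition sober (T : topologicalType) :=
  kolmogorov_space T /\
  forall A : set T, closed A -> irreducible A ->
    exists! x, A = closure [set x].

(* Main.v *)
Require Import Defs.
From HB Require Import structures.
From mathcomp Require Import all_boot all_order.
From mathcomp Require Import boolp classical_sets cardinality topology.

(** In a countable poset Q the sets {U | F `<=` U}, with F finite, form a base of
    the Scott topology on sigma(Q).  Indeed, if s lies in a Scott open family W,
    and Scott open sets u_n outside W contain the first n points of s, then the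
    sets s `&` \bigcap_(m >= n) u_m are Scott open and increase to s, so one of
    them, hence some u_n, lies in W.  An irreducible closed family A meets every
    such basic neighbourhood of its union s, so s belongs to A, and A is the
    closure of s.  The argument is run on pairs directly, a pair of open sets
    being an open set of the disjoint union of L and P. *)

Import Order.TTheory.

Local Open Scope order_scope.
Local Open Scope classical_set_scope.

Section ScottSpace.
Context {d : Order.disp_t} {P : porderType d}.

(* Above a given point of s only finitely many of the u_m matter. *)
Lemma scott_open_locally_finite_cap (s : set P) (u : nat -> set P) :
  scott_open s -> (forall m, scott_open (u m)) ->
  (forall q, s q -> exists N, forall m, (N <= m)%N -> u m q) ->
  scott_open [set q | s q /\ forall m, u m q].
Proof.
move=> so uo fin; split.
  move=> x y [sx ux] xy; split; first exact: so.1 xy.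
  by move=> m; exact: (uo m).1 (ux m) xy.
move=> D x dD Dx [sx ux].
have [e [De se]] := so.2 _ _ dD Dx sx.
have [N uN] := fin _ se.
(* The finitely many [u m] with [m < N] are handled one at a time by directedness; every later [u m]
   contains [e], so an upper bound of [z] and [e] in [D] will do. *)
have: exists2 z, D z & forall m, (m < N)%N -> u m z.
  elim: N {uN} => [|N [z Dz uz]]; first by exists e.
  have [y [Dy uy]] := (uo N).2 _ _ dD Dx (ux N).
  have [t Dt [zt yt]] := dD.2 _ _ Dz Dy.
  exists t => // m; rewrite ltnS leq_eqVlt => /predU1P[-> | mN].
    exact: (uo N).1 uy yt.
  exact: (uo m).1 (uz _ mN) zt.
case=> z Dz uz; have [t Dt [et zt]] := dD.2 _ _ De Dz.
exists t; split=> //; split; first exact: so.1 et.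
move=> m; have [mN | Nm] := ltnP m N; first exact: (uo m).1 (uz _ mN) zt.
exact: (uo m).1 (uN _ Nm) et.
Qed.

Lemma scott_open_not_le (y : P) : scott_open [set x | ~~ (x <= y)].
Proof.
split=> [x z /= nxy xz | D s dD [_ Ds] /= nsy].
  by apply: contra nxy => /(le_trans xz).
apply: contrapT => nD; move/negP: nsy; apply; apply: Ds => x Dx.
by apply/negP => /negP nxy; apply: nD; exists x.
Qed.

Lemma scott_closure1 (x : P) :
  closure [set (x : scott_space P)] = [set y : scott_space P | (y : P) <= x].
Proof.
apply/seteqP; split=> [y cly /= | y /= yx U].
  apply/negP => /negP nyx.
  have oU : open ([set z | ~~ (z <= x)] : set (scott_space P)).
    by rewrite scott_spaceE; exact: scott_open_not_le.
  have [z [/= -> ]] := cly _ (open_nbhs_nbhs (conj oU nyx)).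
  by rewrite lexx.
rewrite nbhsE => -[V [oV Vy] VU]; exists x; split=> //; apply: VU.
by move: oV; rewrite scott_spaceE => -[upV _]; exact: upV yx.
Qed.

Lemma scott_space_kolmogorov : kolmogorov_space (scott_space P).
Proof.
have sep (x y : P) : ~~ (x <= y) -> exists A : set (scott_space P),
    A \in nbhs (x : scott_space P) /\ (y : scott_space P) \in ~` A.
  move=> nxy; exists ([set z | ~~ (z <= y)] : set P).
  split; apply/mem_set; last by move/negP; apply.
  apply: open_nbhs_nbhs; split=> //.
  by rewrite scott_spaceE; exact: scott_open_not_le.
move=> x y nxy; have [xy | /sep[A sepA]] := boolP ((x : P) <= y).
  have /sep[A sepA] : ~~ ((y : P) <= x).
    by apply: contra nxy => yx; apply/eqP/le_anti; rewrite xy.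
  by exists A; right.
by exists A; left.
Qed.

End ScottSpace.

Section Pairs.
Context {dL dP : Order.disp_t} {L : porderType dL} {P : porderType dP}.
Local Notation M := (scott_opens L *p scott_opens P).

(** Turns the product order into inclusion of subsets of [L + P], so that one enumeration of points
    covers both components. *)
Definition sum_mem (p : M) (x : L + P) : Prop :=
  match x with
  | inl l => (p.1 : set L) l
  | inr r => (p.2 : set P) r
  end.

Lemma scott_opens_scott_open d (Q : porderType d) (U : scott_opens Q) :
  scott_open (U : set Q).
Proof. by case: U => U soU; exact: asboolW soU. Qed.

Lemma sum_mem_leP (p q : M) : p <= q <-> (sum_mem p `<=` sum_mem q).
Proof.
rewrite Order.ProdOrder.leEprod; split=> [/andP[pq1 pq2] [l|r] /= | pq].
- by move: l; exact/scott_opens_leP.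
- by move: r; exact/scott_opens_leP.
apply/andP; split; apply/scott_opens_leP => x px.
- exact: (pq (inl x)).
- exact: (pq (inr x)).
Qed.

Lemma sum_mem_exists (A : set (L + P)) :
  scott_open (A \o inl) -> scott_open (A \o inr) -> exists s, sum_mem s = A.
Proof.
move=> soL soP.
exists (ScottOpens (introT (asboolP _) soL), ScottOpens (introT (asboolP _) soP)).
by apply/funext => -[].
Qed.

Lemma sum_mem_bigcup (A : set M) : exists s, sum_mem s = \bigcup_(a in A) sum_mem a.
Proof.
have oU d (Q : porderType d) (g : M -> scott_opens Q) :
    scott_open [set x | exists2 a, A a & (g a : set Q) x].
  have -> : [set x | exists2 a, A a & (g a : set Q) x] =
      \bigcup_(a : {a | A a}) (g (sval a) : set Q).
    apply/seteqP; split=> [x [a Aa gx] | x [[a Aa] _ gx]]; last by exists a.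
    by exists (exist _ a Aa).
  by apply: scott_open_bigU => a; exact: scott_opens_scott_open.
by apply: sum_mem_exists; [exact: (oU _ _ fst) | exact: (oU _ _ snd)].
Qed.

(** The union of [D] is an upper bound of [D], so it contains the supremum [s]; each point of [s]
    thus lies in a member of [D]. *)
Lemma scott_open_sum_mem (x : L + P) : scott_open [set p | sum_mem p x].
Proof.
split=> [p q px /sum_mem_leP | D s _ [_ Ds] /= sx]; first exact.
have [t tE] := sum_mem_bigcup D.
have /sum_mem_leP/(_ _ sx) : s <= t.
  by apply: Ds => a Da; apply/sum_mem_leP; rewrite tE; exact: bigcup_sup.
by rewrite tE => -[a Da ax]; exists a.
Qed.

Lemma sum_mem_locally_finite_cap (s : M) (u : nat -> M) :
  (forall x, sum_mem s x -> exists N, forall m, (N <= m)%N -> sum_mem (u m) x) ->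
  exists w, sum_mem w = [set x | sum_mem s x /\ forall m, sum_mem (u m) x].
Proof.
move=> fin; apply: sum_mem_exists.
- apply: (@scott_open_locally_finite_cap _ _ _ (fun m => (u m).1 : set L)).
  + exact: scott_opens_scott_open.
  + by move=> m; exact: scott_opens_scott_open.
  + by move=> l; exact: (fin (inl l)).
- apply: (@scott_open_locally_finite_cap _ _ _ (fun m => (u m).2 : set P)).
  + exact: scott_opens_scott_open.
  + by move=> m; exact: scott_opens_scott_open.
  + by move=> r; exact: (fin (inr r)).
Qed.

(** For injective [f] only finitely many points have [f x < n], so this puts a basic neighbourhood
    of [s] inside [U]. *)
Lemma scott_open_finite_subbase (f : L + P -> nat) (U : set M) (s : M) :
  scott_open U -> U s ->
  exists n, forall p, (forall x, (f x < n)%N -> sum_mem s x -> sum_mem p x) -> U p.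
Proof.
move=> [upU soU] Us; apply: contrapT => /forallNP nU.
have /choice[u uP] n : exists p, (forall x, (f x < n)%N -> sum_mem s x ->
    sum_mem p x) /\ ~ U p.
  by have /existsNP[p /not_implyP] := nU n; exists p.
(* [w n] is [s] cut down by the tail of [u] from index [n]. It is open because a point [x] of [s]
   lies in [u m] as soon as [f x < m]. *)
have /choice[w wE] n : exists w, sum_mem w =
    [set x | sum_mem s x /\ forall m, sum_mem (u (n + m)%N) x].
  apply: sum_mem_locally_finite_cap => x sx; exists (f x).+1 => m fm.
  by apply: (uP _).1 => //; exact: leq_trans fm (leq_addl _ _).
have w_mono m n : (m <= n)%N -> w m <= w n.
  move=> mn; apply/sum_mem_leP => x; rewrite !wE => -[sx ux]; split=> // k.
  by have := ux (n - m + k)%N; rewrite addnA subnKC.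
have [p [[n _ <-] Uw]] : range w `&` U !=set0.
  apply: soU Us; first split; first by exists (w 0%N); exists 0%N.
    move=> _ _ [m _ <-] [n _ <-]; exists (w (maxn m n)); first by exists (maxn m n).
    by split; apply: w_mono; [exact: leq_maxl | exact: leq_maxr].
  split=> [_ [n _ <-] | t ubt].
    by apply/sum_mem_leP => x; rewrite wE => -[].
  (* [s] is the least upper bound: each of its points [x] already lies in [w (f x).+1]. *)
  apply/sum_mem_leP => x sx.
  have /sum_mem_leP : w (f x).+1 <= t by apply: ubt; exists (f x).+1.
  apply; rewrite wE; split=> // m; apply: (uP _).1 => //.
  by rewrite addSn ltnS leq_addr.
(* The first term of the tail gives [w n <= u n], which forces [u n] into [U]. *)
apply: (uP n).2; apply: upU Uw _; apply/sum_mem_leP => x; rewrite wE => -[_].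
by move/(_ 0%N); rewrite addn0.
Qed.

End Pairs.

(** Otherwise the closed complements of [U] and [V] cover [A], and irreducibility puts [A] inside
    one of them. *)
Lemma irreducible_openI (T : topologicalType) (A U V : set T) :
  irreducible A -> open U -> open V ->
  A `&` U !=set0 -> A `&` V !=set0 -> A `&` (U `&` V) !=set0.
Proof.
move=> [_ irrA] oU oV [x [Ax Ux]] [y [Ay Vy]].
apply: contrapT => /nonemptyPn AUV.
have AC : A `<=` ~` U `|` ~` V.
  move=> z Az; rewrite -setCI => UVz.
  by have : (A `&` (U `&` V)) z by []; rewrite AUV.
have [/(_ _ Ax) | /(_ _ Ay)] := irrA _ _ (open_closedC oU) (open_closedC oV) AC;
  exact.
Qed.

Theorem theorem3p3 (dL dP : Order.disp_t)
  (L : porderType dL) (P : porderType dP)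
  (cL : countable [set: L]) (cP : countable [set: P]) :
  sober (scott_space (scott_opens L *p scott_opens P)).
Proof.
split; first exact: scott_space_kolmogorov.
move=> A clA irrA.
have /countable_injP[fL injL] := cL.
have /countable_injP[fP injP] := cP.
(* Even codes for [L] and odd codes for [P] keep the numbering injective. *)
pose f (x : L + P) := match x with inl l => (fL l).*2 | inr r => (fP r).*2.+1 end.
have injf : injective f.
  move=> [l|r] [l'|r'] //= ff.
  - by congr inl; apply: injL; rewrite ?inE //; exact: double_inj.
  - by have := congr1 odd ff; rewrite /= !odd_double.
  - by have := congr1 odd ff; rewrite /= !odd_double.
  - by congr inr; apply: injP; rewrite ?inE //; apply: double_inj; case: ff.
have soA : scott_open (~` (A : set (scott_opens L *p scott_opens P))).
  by rewrite -scott_spaceE; exact: closed_openC.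
have [s sE] := sum_mem_bigcup A.
pose O n := [set p : scott_space (scott_opens L *p scott_opens P) |
  forall x, (f x < n)%N -> sum_mem s x -> sum_mem p x].
(* Passing from [O n] to [O n.+1] adds at most one condition, by injectivity of [f]: membership of a
   point of [s], which some member of [A] satisfies. *)
have AO n : open (O n) /\ A `&` O n !=set0.
  elim: n => [|n [oO AOn]].
    have -> : O 0%N = setT by apply/seteqP; split.
    by split; [exact: openT | rewrite setIT; exact: irrA.1].
  have [[x [fx sx]] | nx] := pselect (exists x, f x = n /\ sum_mem s x).
    have -> : O n.+1 = O n `&` [set p | sum_mem p x].
      apply/seteqP; split=> [p Op | p [Op px] y].
        by split=> [y yn|]; apply: Op; rewrite ?fx // ltnW.
      by rewrite ltnS leq_eqVlt => /predU1P[|/Op//]; rewrite -fx => /injf->.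
    have ox : open ([set p | sum_mem p x] :
        set (scott_space (scott_opens L *p scott_opens P))).
      by rewrite scott_spaceE; exact: scott_open_sum_mem.
    split; first exact: openI.
    apply: irreducible_openI => //.
    by move: sx; rewrite sE => -[a Aa ax]; exists a.
  suff -> : O n.+1 = O n by [].
  apply/seteqP; split=> p Op y yn; first by apply: Op; exact: ltnW.
  move: yn; rewrite ltnS leq_eqVlt => /predU1P[yn sy|]; last exact: Op.
  by exfalso; apply: nx; exists y.
(* If [s] were outside [A], the open complement of [A] would contain some [O n], which meets [A]. *)
have As : A s.
  apply: contrapT => nAs.
  have [n On] := scott_open_finite_subbase f _ _ soA nAs.
  by have [_ [p [Ap /On]]] := AO n.
exists s; split=> [|t].
  rewrite scott_closure1; apply/seteqP; split=> p /= => [Ap | ps].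
    by apply/sum_mem_leP; rewrite sE; exact: bigcup_sup.
  by apply: contrapT => nAp; exact: soA.1 nAp ps As.
(* Both [s] and [t] are greatest elements of [A], point closures being principal ideals. *)
move=> AE; apply: le_anti; apply/andP; split.
  by have : A s by []; rewrite AE scott_closure1.
apply/sum_mem_leP; rewrite sE; apply: bigcup_sup.
by rewrite AE scott_closure1 /=.
Qed.
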